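(* Let $N\ge 2$, let $\alpha\in[0,\infty)$ and let $m=\lfloor N^{\alpha}\rfloor$. Consider the quantum walk on the graph $K_N\wedge_{v^*}S_m$ with time evolution operator $U$, initial state $\psi_0$ and success probability $p_t(v^* )$ as described in the context. Then for sufficiently large $N$ and any $\alpha\in[0,\infty)$ there exists a time $t_{\mathrm{opt}}=t_{\mathrm{opt}}(N)\in\mathbb{N}$ such that $$p_{t_{\mathrm{opt}}}(v^* )=\frac12+o(1)\qquad (N\to\infty).$$
   Context: $K_N$ is the complete graph on $N$ vertices and $S_m$ is the star graph (a tree with one center vertex and $m$ leaves). The graph $K_N\wedge_{v^*}S_m$ is obtained from the disjoint union of $K_N$ and $S_m$ by identifying one fixed vertex of $K_N$ with the center of $S_m$; the identified vertex is denoted $v^*$ (so $\deg(v^* )=N-1+m$). Let $V_S$ denote the set of the $m$ leaves of the star. Let $A$ be the set of symmetric arcs (each edge gives two opposite arcs); for an arc $a$, $o(a)$ and $t(a)$ are its origin and terminus, $\bar a$ is its inverse arc, and $\deg(v)=|\{a\in A: t(a)=v\}|$. The time evolution operator $U$ on $\mathbb{C}^A$ is $U=S(2d^*d-I)$, where $(S\psi)(a)=\psi(\bar a)$ and $d:\mathbb{C}^A\to\mathbb{C}^V$ is given by $(d\psi)(v)=\deg(v)^{-1/2}\sum_{a:t(a)=v}\psi(a)$ for $v\notin V_S$ and $(d\psi)(v)=0$ for $v\in V_S$. Explicitly, for $\psi\in\mathbb{C}^A$ and $a\in A$: $(U\psi)(a)=-\psi(\bar a)+\frac{2}{\deg(t(a))}\sum_{b\in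 A:\,o(b)=t(a)}\psi(b)$ if $t(a)\notin V_S$, and $(U\psi)(a)=-\psi(\bar a)$ if $t(a)\in V_S$ (phase reversal at the leaves). The initial state is $\psi_0(a)=1/\sqrt{N(N-1)}$ for $a\in A(K_N)$ and $\psi_0(a)=0$ otherwise, and $\psi_t=U^t\psi_0$. The probability of finding vertex $v$ at time $t$ is $p_t(v)=\sum_{a\in A:\,t(a)=v}|\psi_t(a)|^2$. *)

(* Defs.v *)
From mathcomp Require Import all_boot all_order all_algebra.
From mathcomp Require Import all_classical all_reals all_analysis.
From mathcomp Require Export complex.
Set Implicit Arguments. Unset Strict Implicit. Unset Printing Implicit Defensive.
Import Order.TTheory GRing.Theory Num.Theory.
Local Open Scope ring_scope.
Local Open Scope complex_scope.

(* Vertices of K_N ∧_{v*} S_m : inl i = vertex i of K_N (i < N),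
   inr k = k-th leaf of the star (k < m).  The distinguished vertex v* is the
   K_N vertex with index 0 (it is identified with the star's centre). *)
Definition vtx (N m : nat) : finType := ('I_N + 'I_m)%type.

Definition is_vstar (N m : nat) (v : vtx N m) : bool :=
  if v is inl i then val i == 0%N else false.

Definition is_leaf (N m : nat) (v : vtx N m) : bool :=
  if v is inr _ then true else false.

Definition adj (N m : nat) (u v : vtx N m) : bool :=
  match u, v with
  | inl i, inl j => i != j
  | inl i, inr _ => val i == 0%N
  | inr _, inl j => val j == 0%N
  | inr _, inr _ => false
  end.

(* Arcs are the ordered pairs (u,v) with adj u v; arc (u,v) has origin u,
   terminus v, inverse (v,u).  A vector of C^A is represented as a function
   on pairs of vertices; only its values on arcs matter (U keeps it 0 off arcs). *)
Definition state (R : realType) (N m : nat) := vtx N m -> vtx N m -> R[i].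

Definition deg (N m : nat) (v : vtx N m) : nat := #|[pred u | adj u v]|.

(* time evolution operator U = S(2 d^* d - I) with phase reversal at leaves *)
Definition Uop (R : realType) (N m : nat) (psi : state R N m) : state R N m :=
  fun u v =>
    if adj u v then
      if is_leaf v then - psi v u
      else - psi v u + ((2 / (deg v)%:R : R)%:C) * \sum_(w | adj v w) psi v w
    else 0.

Definition psi0 (R : realType) (N m : nat) : state R N m :=
  fun u v =>
    if adj u v && ~~ is_leaf u && ~~ is_leaf v then
      ((1 / Num.sqrt ((N * (N - 1))%:R) : R)%:C)
    else 0.

Definition psi_t (R : realType) (N m t : nat) : state R N m :=
  iter t (@Uop R N m) (@psi0 R N m).

Definition sqnorm (R : realType) (z : R[i]) : R :=
  complex.Re z ^+ 2 + complex.Im z ^+ 2.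

Definition prob (R : realType) (N m t : nat) (v : vtx N m) : R :=
  \sum_(u | adj u v) sqnorm (@psi_t R N m t u v).

(* success probability p_t(vstar) (vstar = K_N vertex 0; requires N > 0) *)
Definition success (R : realType) (N m t : nat) : R :=
  \sum_(v : vtx N m | is_vstar v) (@prob R N m t v).

Definition mstar (R : realType) (alpha : R) (N : nat) : nat :=
  Num.truncn ((N%:R : R) `^ alpha).

(* Main.v *)
(* With n = N - 1, the walk stays among the states that are constant on the five
   symmetry classes of arcs, so it is an orthogonal map of R^5.  This map U is a
   product of two involutions, one of them the arc reversal S; hence S U S = U^-1
   and U + U^-1 commutes with S.  Besides -1, U has two pairs of conjugate
   eigenvalues; the one near 1 is exp(+-iw) with cos w = y, where y is the root
   in [1 - 2/n, 1) of y^2 = (1 - 1/n) y + 1/(n + m).  Its real invariant plane is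
   spanned by an S-symmetric p and an S-antisymmetric q of equal norm, rotated
   by w at each step.  The vector p is within O(1/sqrt n) of the initial state,
   uniformly in m >= 1, so after about pi/(2w) steps the state is close to -q;
   and exactly half of the mass of an antisymmetric q without K_N - v* part sits
   on the arcs ending at v*. *)
Require Import Defs.
From mathcomp Require Import all_boot all_order all_algebra.
From mathcomp Require Import all_classical all_reals all_analysis.
From mathcomp Require Import complex ring lra.
Import Order.TTheory GRing.Theory Num.Theory.
Import numFieldNormedType.Exports.
Local Open Scope ring_scope.
Local Open Scope classical_set_scope.

Set Implicit Arguments.
Unset Strict Implicit.
Unset Printing Implicit Defensive.

(** * The walk on five amplitudes: linearity, reversal, isometry *)

Section FiveState.
Variables (R : realType) (n m : R).
Hypotheses (n_gt0 : 0 < n) (m_gt0 : 0 < m).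

Definition vec5 : Type := (R * R * R * R * R)%type.

(* A vec5 (a, b, c, x, z) holds the common amplitudes on the arcs K_N -> v*,
   v* -> K_N, those of K_N avoiding v*, leaf -> v* and v* -> leaf; n = N - 1. *)
Definition step5 (v : vec5) : vec5 :=
  let: (a, b, c, x, z) := v in
  (((n - m) * b + 2 * m * z) / (n + m),
   (2 / n - 1) * a + 2 * (n - 1) / n * c,
   (1 - 2 / n) * c + 2 / n * a,
   (2 * n * b + (m - n) * z) / (n + m),
   - x).

Definition swap5 (v : vec5) : vec5 := let: (a, b, c, x, z) := v in (b, a, c, z, x).

Definition comb5 (k l : R) (u v : vec5) : vec5 :=
  let: (a, b, c, x, z) := u in let: (a', b', c', x', z') := v in
  (k * a + l * a', k * b + l * b', k * c + l * c', k * x + l * x', k * z + l * z').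

(** The weights are the numbers of arcs in the classes, so this is the squared norm of the full
    state. *)
Definition nrm5 (v : vec5) : R :=
  let: (a, b, c, x, z) := v in
  n * (a ^+ 2 + b ^+ 2) + n * (n - 1) * c ^+ 2 + m * (x ^+ 2 + z ^+ 2).

Definition found5 (v : vec5) : R :=
  let: (a, _, _, x, _) := v in n * a ^+ 2 + m * x ^+ 2.

Lemma step5_comb k l u v : step5 (comb5 k l u v) = comb5 k l (step5 u) (step5 v).
Proof.
case: u => [[[[a b] c] x] z]; case: v => [[[[a' b'] c'] x'] z'] /=.
by congr (_, _, _, _, _); ring.
Qed.

(** [step5] is [swap5] after an involution. On a [swap5]-symmetric [v], this makes [swap5 (step5 v)]
    the preimage of [v] under [step5]. *)
Lemma swap5_step5 v : step5 (swap5 (step5 v)) = swap5 v.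
Proof.
case: v => [[[[a b] c] x] z] /=.
have D0 : n + m != 0 by rewrite lt0r_neq0 ?addr_gt0.
have n0 := lt0r_neq0 n_gt0.
by congr (_, _, _, _, _); field; rewrite ?n0 ?D0.
Qed.

Lemma nrm5_step v : nrm5 (step5 v) = nrm5 v.
Proof.
case: v => [[[[a b] c] x] z] /=.
have D0 : n + m != 0 by rewrite lt0r_neq0 ?addr_gt0.
have n0 := lt0r_neq0 n_gt0.
by field; rewrite ?n0 ?D0.
Qed.

Lemma nrm5_iter_sub t u v :
  nrm5 (comb5 1 (-1) (iter t step5 u) (iter t step5 v)) = nrm5 (comb5 1 (-1) u v).
Proof. by elim: t => //= t <-; rewrite -step5_comb nrm5_step. Qed.

Lemma nrm5_ge0 v : 1 <= n -> 0 <= nrm5 v.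
Proof.
move=> n1; case: v => [[[[a b] c] x] z] /=.
have n0 := ltW n_gt0; have m0 := ltW m_gt0; have n10 : 0 <= n - 1 by rewrite subr_ge0.
by apply: addr_ge0; first apply: addr_ge0; apply: mulr_ge0; rewrite ?sqr_ge0 //;
  by [apply: addr_ge0; rewrite sqr_ge0 | apply: mulr_ge0].
Qed.

(** Parallelogram identity: the slack is [nrm5] of the difference. *)
Lemma nrm5_add_le u v : 1 <= n -> nrm5 (comb5 1 1 u v) <= 2 * nrm5 u + 2 * nrm5 v.
Proof.
move=> n1; suff: 0 <= 2 * nrm5 u + 2 * nrm5 v - nrm5 (comb5 1 1 u v) by lra.
have := nrm5_ge0 (comb5 1 (-1) u v) n1.
case: u => [[[[a b] c] x] z]; case: v => [[[[a' b'] c'] x'] z'] /=.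
by move=> h; apply: le_trans h _; rewrite le_eqVlt; apply/orP; left; apply/eqP; ring.
Qed.

Lemma found5_le v : 1 <= n -> found5 v <= nrm5 v.
Proof.
move=> n1; case: v => [[[[a b] c] x] z] /=.
rewrite -subr_ge0.
have -> : n * (a ^+ 2 + b ^+ 2) + n * (n - 1) * c ^+ 2 + m * (x ^+ 2 + z ^+ 2)
   - (n * a ^+ 2 + m * x ^+ 2) = n * b ^+ 2 + n * (n - 1) * c ^+ 2 + m * z ^+ 2 by ring.
have n0 := ltW n_gt0; have m0 := ltW m_gt0; have n10 : 0 <= n - 1 by rewrite subr_ge0.
by apply: addr_ge0; first apply: addr_ge0; apply: mulr_ge0; rewrite ?sqr_ge0 //;
  by [apply: addr_ge0; rewrite sqr_ge0 | apply: mulr_ge0].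
Qed.

Lemma found5_perturb (d : R) e w : 0 < d ->
  `|found5 (comb5 1 1 e w) - found5 w| <= d * found5 w + (1 + d^-1) * found5 e.
Proof.
case: e => [[[[a b] c] x] z]; case: w => [[[[a' b'] c'] x'] z'] /= d0.
have dn0 := lt0r_neq0 d0.
have di0 : 0 <= d^-1 by rewrite invr_ge0 ltW.
have n0 := ltW n_gt0; have m0 := ltW m_gt0.
have q_ge0 u v : 0 <= n * u ^+ 2 + m * v ^+ 2.
  by apply: addr_ge0; apply: mulr_ge0; rewrite ?sqr_ge0.
(* The two bounds are [0 <= d^-1 |d w - e|^2] and [0 <= d^-1 |d w + e|^2 + 2 |e|^2]. *)
have h1 := mulr_ge0 di0 (q_ge0 (d * a' - a) (d * x' - x)).
have h2 := addr_ge0 (mulr_ge0 di0 (q_ge0 (d * a' + a) (d * x' + x)))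
  (mulr_ge0 (ler0n R 2) (q_ge0 a x)).
rewrite ler_norml; apply/andP; split; rewrite -subr_ge0.
  by apply: le_trans h2 _; rewrite le_eqVlt; apply/orP; left; apply/eqP; field.
by apply: le_trans h1 _; rewrite le_eqVlt; apply/orP; left; apply/eqP; field.
Qed.

Lemma comb5_solve y s u v p : s != 0 -> comb5 y s u v = p -> v = comb5 s^-1 (- (y / s)) p u.
Proof.
case: u => [[[[a b] c] x] z]; case: v => [[[[a' b'] c'] x'] z'] /= s0 <- /=.
by congr (_, _, _, _, _); field.
Qed.

End FiveState.

(** * The invariant plane of the eigenvalues near 1 *)

Section Plane.
Variables (R : realType) (n m : R).
Hypotheses (n_gt0 : 0 < n) (m_gt0 : 0 < m).
Notation step5 := (step5 n m).
Notation nrm5 := (nrm5 n m).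
Notation found5 := (found5 n m).

(** At m = 0 the larger root of the quadratic would be 1; a positive m makes 1/(n + m) smaller than
    1/n, which pushes it strictly below 1. The lower bound later gives sin w = O(1/sqrt n). *)
Lemma resonant_root : 2 <= n ->
  exists y : R, [/\ 1 - 2 / n <= y, y < 1 & y ^+ 2 = (1 - n^-1) * y + (n + m)^-1].
Proof.
move=> n2; pose k := n^-1; pose h := (n + m)^-1.
have h0 : 0 < h by rewrite invr_gt0 addr_gt0.
have k0 : 0 < k by rewrite invr_gt0.
have hk : h < k by rewrite ltf_pV2 ?posrE ?addr_gt0 // ltrDl.
have k12 : k <= 2^-1 by rewrite lef_pV2 ?posrE.
pose S := Num.sqrt ((1 - k) ^+ 2 + 4 * h).
have S0 : 0 <= S by rewrite sqrtr_ge0.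
have S2 : S ^+ 2 = (1 - k) ^+ 2 + 4 * h by rewrite sqr_sqrtr // addr_ge0 ?sqr_ge0 ?mulr_ge0 // ltW.
exists ((1 - k + S) / 2); rewrite -/h -/k; split.
- suff: 1 - 3 * k <= S by lra.
  rewrite leNgt; apply/negP => hS.
  by have := mulr_ge0 S0 S0; nra.
- suff: S < 1 + k by lra.
  rewrite ltNge; apply/negP => hS.
  nra.
- have -> : ((1 - k + S) / 2) ^+ 2 = ((1 - k) ^+ 2 + 2 * (1 - k) * S + S ^+ 2) / 4 by field.
  by rewrite S2; field.
Qed.

(* The second relation of the eigenvalue equation, n a = (y (n + m) + n) l, has
   been simplified to l = a - 1/2 by means of the quadratic equation for y. *)
Definition plane_vec (s y : R) : vec5 R :=
  let a := 1 - n * (1 - y) / 2 in let l := a - 1 / 2 in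
  (s * a, s * a, s, s * l, s * l).

(* As plane_vec is symmetric, this is the equation U p + U^-1 p = 2 y p. *)
Lemma plane_vec_chebyshev (s y : R) : y ^+ 2 = (1 - n^-1) * y + (n + m)^-1 ->
  comb5 1 1 (step5 (plane_vec s y)) (swap5 (step5 (plane_vec s y)))
  = comb5 (2 * y) 0 (plane_vec s y) (plane_vec s y).
Proof.
move=> y2; have D0 : n + m != 0 by rewrite lt0r_neq0 ?addr_gt0.
have n0 := lt0r_neq0 n_gt0.
have hE : (n + m)^-1 = y ^+ 2 - (1 - n^-1) * y by rewrite y2; ring.
rewrite /plane_vec /=.
set a := 1 - n * (1 - y) / 2.
have E1 : ((n - m) * (s * a) + 2 * m * (s * (a - 1 / 2))) / (n + m)
  = s * (a - 1 + n * (n + m)^-1) by field.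
have E2 : (2 * n * (s * a) + (m - n) * (s * (a - 1 / 2))) / (n + m)
  = s * (a - 1 / 2 + n * (n + m)^-1) by field.
rewrite E1 E2 hE /a; congr (_, _, _, _, _); field; exact: n0.
Qed.

(** The vector q is defined by U p = y p - sg q. The relation U p + S U p = 2 y p makes it
    antisymmetric, with no clique part, and gives S U p = y p + sg q. Applying U to the latter
    yields p = y U p + sg U q, which is solved for U q. Since p and q are orthogonal, isometry gives
    |p|^2 = y^2 |p|^2 + sg^2 |q|^2, hence equal norms. *)
Lemma invariant_plane (s y : R) : y ^+ 2 = (1 - n^-1) * y + (n + m)^-1 -> 0 < 1 - y ^+ 2 ->
  exists u v, let p := plane_vec s y in let q := (u, - u, 0, v, - v) in
  [/\ step5 p = comb5 y (- Num.sqrt (1 - y ^+ 2)) p q,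
      step5 q = comb5 (Num.sqrt (1 - y ^+ 2)) y p q & nrm5 q = nrm5 p].
Proof.
move=> y2 y1; set sg := Num.sqrt _.
have sg0 : sg != 0 by rewrite lt0r_neq0 // sqrtr_gt0.
have sg2 : sg ^+ 2 = 1 - y ^+ 2 by rewrite sqr_sqrtr // ltW.
have := plane_vec_chebyshev s y2.
have := swap5_step5 n_gt0 m_gt0 (plane_vec s y).
have := nrm5_step n_gt0 m_gt0 (plane_vec s y).
have := step5_comb n m.
case Ep : (step5 _) => [[[[p1 p2] p3] p4] p5].
rewrite /plane_vec; set a := 1 - _; set l := a - _.
move=> lin nrmp swp /= [e1 e2 e3 e4 e5].
have F2 : p2 = 2 * y * (s * a) - p1 by lra.
have F3 : p3 = y * s by lra.
have F5 : p5 = 2 * y * (s * l) - p4 by lra.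
pose u := (y * (s * a) - p1) / sg; pose v := (y * (s * l) - p4) / sg.
have Ec : (p1, p2, p3, p4, p5) =
   comb5 y (- sg) (s * a, s * a, s, s * l, s * l) (u, - u, 0, v, - v).
  by rewrite /= F2 F3 F5 /u /v; congr (_, _, _, _, _); field.
exists u, v; cbv zeta; split.
- exact: etrans Ep Ec.
- have : comb5 y sg (step5 (s * a, s * a, s, s * l, s * l)) (step5 (u, - u, 0, v, - v))
      = (s * a, s * a, s, s * l, s * l).
    rewrite -lin; apply: (etrans _ swp); congr (step5 _) => /=.
    by rewrite F2 F3 F5 /u /v; congr (_, _, _, _, _); field.
  move/(comb5_solve sg0) => H; apply: (etrans H).
  rewrite [step5 _]Ep Ec /=.
  have -> : sg^-1 = sg / (1 - y ^+ 2) by rewrite -sg2; field.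
  have K : 1 - y ^+ 2 != 0 by rewrite lt0r_neq0.
  congr (_, _, _, _, _); field: sg2; exact: K.
- move: nrmp; rewrite Ec /= => nrmp.
  apply: (mulfI (lt0r_neq0 y1)); rewrite -{1}sg2.
  move: nrmp; set Q := n * ((s * a) ^+ 2 + _) + _ + _ => nrmp.
  have : Q - y ^+ 2 * Q = sg ^+ 2 *
     (n * (u ^+ 2 + (- u) ^+ 2) + n * (n - 1) * 0 ^+ 2 + m * (v ^+ 2 + (- v) ^+ 2)).
    by rewrite -[X in X - _]nrmp /Q; ring.
  by rewrite mulrBl mul1r => ->.
Qed.

End Plane.

(** * Quarter turn in the plane and the explicit error bound *)

Lemma quarter_turn (R : realType) (w : R) : 0 < w -> w <= pi / 2 ->
  exists t : nat, 0 <= cos (t%:R * w) <= sin w /\ 0 <= sin (t%:R * w).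
Proof.
move=> w0 wpi; have pi0 := pi_gt0 R.
(* The whole steps of angle w that fit in pi/2: t w lies in (pi/2 - w, pi/2], where the cosine is at
   most cos (pi/2 - w) = sin w. *)
exists (Num.truncn (pi / 2 / w)).
have /andP[] := truncn_itv (ltW (divr_gt0 (divr_gt0 pi0 (ltr0n R 2)) w0)).
set t := Num.truncn _; rewrite ler_pdivlMr // ltr_pdivrMr // -[t.+1%:R]natr1 (mulrDl t%:R) mul1r.
move=> t1 t2.
have t0 : 0 <= t%:R * w by rewrite mulr_ge0 // ltW.
split; last by apply: sin_ge0_pi; apply/andP; split=> //; lra.
apply/andP; split; first by apply: cos_ge0_pihalf; apply/andP; split=> //; lra.
rewrite -(cosBpihalf w) -[cos (w - _)]cosN opprB.
rewrite leNgt ltr_cos ?in_itv /= -?leNgt; first lra.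
- by apply/andP; split; lra.
- by apply/andP; split; lra.
Qed.

Section Search.
Variables (R : realType) (n m : R).
Notation step5 := (step5 n m).
Notation nrm5 := (nrm5 n m).
Notation found5 := (found5 n m).

Lemma rotation_iter w p q t :
  step5 p = comb5 (cos w) (- sin w) p q -> step5 q = comb5 (sin w) (cos w) p q ->
  iter t step5 p = comb5 (cos (t%:R * w)) (- sin (t%:R * w)) p q.
Proof.
move=> Hp Hq; elim: t => [|t IH] /=.
  rewrite mul0r cos0 sin0; case: p {Hp Hq} => [[[[a b] c] x] z]; case: q => [[[[? ?] ?] ?] ?] /=.
  by congr (_, _, _, _, _); ring.
rewrite IH step5_comb Hp Hq -[t.+1%:R]natr1 (mulrDl t%:R) mul1r cosD sinD.
case: p {Hp Hq IH} => [[[[a b] c] x] z]; case: q => [[[[? ?] ?] ?] ?] /=.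
by congr (_, _, _, _, _); ring.
Qed.

Lemma found5_near_half (s : R) : 4 <= n -> 1 <= m -> s ^+ 2 * (n * (n + 1)) = 1 ->
  exists t : nat,
    `|found5 (iter t step5 (s, s, s, 0, 0)) - 1 / 2| <= 74 / Num.sqrt n.
Proof.
move=> n4 m1 s2.
have n_gt0 : 0 < n by lra.
have m_gt0 : 0 < m by lra.
have n1 : 1 <= n by lra.
have n2 : 2 <= n by lra.
have [y [ylo yhi y2]] := resonant_root n_gt0 m_gt0 n2.
have k0 : 0 < n^-1 by rewrite invr_gt0.
have k4 : n^-1 <= 4^-1 by rewrite lef_pV2 ?posrE.
have y12 : 1 / 2 <= y by lra.
have sg2 : 1 - y ^+ 2 <= 4 / n by nra.
have sg_gt0 : 0 < 1 - y ^+ 2 by nra.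
have [u [v]] := invariant_plane n_gt0 m_gt0 s y2 sg_gt0.
set p := plane_vec n s y; set q := (u, - u, 0, v, - v); move=> [stp stq nq].
have y11 : -1 <= y <= 1 by apply/andP; split; lra.
pose w := acos y.
have cw : cos w = y by rewrite /w acosK // in_itv.
have sw : sin w = Num.sqrt (1 - y ^+ 2) by rewrite /w sin_acos.
have w0 : 0 < w by apply: acos_gt0; apply/andP; split; lra.
have wpi : w <= pi.
  exact: acos_lepi.
have wpi2 : w <= pi / 2.
  have pi0 := pi_gt0 R.
  rewrite leNgt; apply/negP => h.
  have : cos w < cos (pi / 2).
    by rewrite ltr_cos ?in_itv //=; apply/andP; split; lra.
  by rewrite cos_pihalf cw; lra.
have [t [/andP[ct0 ct1] st0]] := quarter_turn w0 wpi2.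
exists t.
set psi := iter t step5 (s, s, s, 0, 0).
rewrite -sw -cw in stp stq.
have rp := rotation_iter t stp stq.
set C := cos (t%:R * w) in ct0 ct1 rp.
set S := sin (t%:R * w) in st0 rp.
have C2 : C ^+ 2 <= 4 / n.
  apply: le_trans sg2; rewrite -[leRHS]sqr_sqrtr -?sw; last exact: ltW.
  by rewrite ler_sqr ?nnegrE // (le_trans ct0).
have CS : C ^+ 2 + S ^+ 2 = 1 by exact: cos2Dsin2.
have S1C : (1 - S) ^+ 2 <= C ^+ 2 by have := sqr_ge0 C; nra.
pose l := 1 / 2 - n * (1 - y) / 2.
have pE : p = (s * (l + 1 / 2), s * (l + 1 / 2), s, s * l, s * l).
  by rewrite /p /plane_vec /l; congr (_, _, _, _, _); field.
have D_gt0 : 0 < n + m by lra.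
(* The quadratic equation makes the star amplitude [l] decay like n/(n + m). With [l] at most 1/2
   this bounds m l^2 by n/2, uniformly in m. *)
have ly : 2 * y * l = n / (n + m).
  have -> : 2 * y * l = n * (y ^+ 2 - (1 - n^-1) * y).
    by rewrite /l; field; exact: lt0r_neq0.
  by rewrite y2; ring.
have l_gt0 : 0 < l.
  have : 0 < 2 * y * l by rewrite ly divr_gt0.
  by rewrite pmulr_rgt0 //; lra.
have l12 : l <= 1 / 2 by rewrite /l; nra.
have lD : l * (n + m) <= n.
  have : 2 * y * l * (n + m) = n by rewrite ly divfK // lt0r_neq0.
  by nra.
have ml2 : m * l ^+ 2 <= n / 2 by nra.
have ml20 : 0 <= m * l ^+ 2 by rewrite mulr_ge0 ?sqr_ge0 // ltW.
have al : 0 <= (1 / 2 - l) ^+ 2 <= 1 / 4 by apply/andP; split; nra.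
have bl : 1 / 4 <= (1 / 2 + l) ^+ 2 <= 1 by apply/andP; split; nra.
set P := nrm5 p in nq.
have s20 : 0 <= s ^+ 2 := sqr_ge0 s.
have s2n : s ^+ 2 * n <= n^-1.
  have -> : n^-1 = s ^+ 2 * (n + 1).
    by apply: (mulfI (lt0r_neq0 n_gt0)); rewrite divff ?lt0r_neq0 //; apply: (etrans (esym s2)); ring.
  by rewrite ler_wpM2l //; lra.
have Phi : P <= 1 + n^-1.
  have -> : P = s ^+ 2 * (2 * (n * (1 / 2 + l) ^+ 2) + n * (n - 1) + 2 * (m * l ^+ 2)).
    by rewrite /P pE /=; field.
  apply: (@le_trans _ _ (s ^+ 2 * (n * (n + 1) + n))); last by rewrite mulrDr s2 lerD2l.
  rewrite ler_wpM2l //; case/andP: bl => _ bl.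
  have := ler_wpM2l (ltW n_gt0) bl; lra.
have Plo : 1 - 2 / n <= P.
  have -> : P = s ^+ 2 * (2 * (n * (1 / 2 + l) ^+ 2) + n * (n - 1) + 2 * (m * l ^+ 2)).
    by rewrite /P pE /=; field.
  suff : s ^+ 2 * (n * (n + 1)) - 2 * (s ^+ 2 * n) <= 
    s ^+ 2 * (2 * (n * (1 / 2 + l) ^+ 2) + n * (n - 1) + 2 * (m * l ^+ 2)) by lra.
  have -> : s ^+ 2 * (n * (n + 1)) - 2 * (s ^+ 2 * n) = s ^+ 2 * (n * (n - 1)) by ring.
  rewrite ler_wpM2l //.
  have := mulr_ge0 (ltW n_gt0) (sqr_ge0 (1 / 2 + l)); lra.
(* By isometry this has the norm of the gap at time 0, which lives only on the arcs at [v*]. *)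
pose d := comb5 1 (-1) psi (iter t step5 p).
have nd : nrm5 d <= 2 / n.
  rewrite /d /psi nrm5_iter_sub // pE /=.
  have -> : n * ((1 * s + -1 * (s * (l + 1 / 2))) ^+ 2 + (1 * s + -1 * (s * (l + 1 / 2))) ^+ 2)
     + n * (n - 1) * (1 * s + -1 * s) ^+ 2
     + m * ((1 * 0 + -1 * (s * l)) ^+ 2 + (1 * 0 + -1 * (s * l)) ^+ 2)
     = s ^+ 2 * (2 * (n * (1 / 2 - l) ^+ 2) + 2 * (m * l ^+ 2)) by field.
  suff : s ^+ 2 * (2 * (n * (1 / 2 - l) ^+ 2) + 2 * (m * l ^+ 2)) <= s ^+ 2 * (2 * n) by lra.
  rewrite ler_wpM2l //.
  case/andP: al => _ al; have := ler_wpM2l (ltW n_gt0) al; lra.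
(* Since U^t p = C p - S q, this is U^t p + q. The cross terms vanish by symmetry, so the squared
   norms add. *)
pose r := comb5 C (1 - S) p q.
have nr : nrm5 r = (C ^+ 2 + (1 - S) ^+ 2) * P.
  rewrite mulrDl -{2}nq /r /q /P pE /=; ring.
have P2 : 0 <= P <= 2 by apply/andP; split; lra.
have nr16 : nrm5 r <= 16 / n.
  rewrite nr; apply: (@le_trans _ _ ((C ^+ 2 + (1 - S) ^+ 2) * 2)).
    by rewrite ler_wpM2l ?addr_ge0 ?sqr_ge0 //; case/andP: P2.
  by lra.
pose e := comb5 1 1 d r.
(* 36 = 2 * 2 + 2 * 16, from the bounds on [d] and [r]. *)
have ne : nrm5 e <= 36 / n by have := nrm5_add_le n_gt0 m_gt0 d r n1; rewrite -/e; lra.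
pose w5 := comb5 (-1) 0 q q.
have psiE : psi = comb5 1 1 e w5.
  rewrite /e /d rp /r /w5 /q pE; case: (psi) => [[[[? ?] ?] ?] ?] /=.
  by congr (_, _, _, _, _); ring.
have fw : found5 w5 = P / 2 by rewrite -nq /w5 /q /=; field.
have sn0 : 0 < Num.sqrt n by rewrite sqrtr_gt0.
(* The weight in [found5_perturb] that balances its two terms: they are at most k and 36 k + 36 k^2.
   Adding |P/2 - 1/2| <= k^2 gives 74 k. *)
pose k := (Num.sqrt n)^-1.
have kk0 : 0 < k by rewrite invr_gt0.
have kn : n^-1 = k ^+ 2 by rewrite /k exprVn sqr_sqrtr // ltW.
have := found5_perturb n_gt0 m_gt0 e w5 kk0.
rewrite -psiE fw invrK.
have fe : found5 e <= 36 / n := le_trans (found5_le n_gt0 m_gt0 e n1) ne.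
have sn1 : 1 <= Num.sqrt n by have := ler_wsqrtr n1; rewrite sqrtr1.
have k1 : k <= 1 by rewrite invf_le1.
have : (1 + Num.sqrt n) * found5 e <= (1 + Num.sqrt n) * (36 * k ^+ 2).
  by rewrite -kn ler_wpM2l // addr_ge0 // ltW.
have -> : (1 + Num.sqrt n) * (36 * k ^+ 2) = 36 * k ^+ 2 + 36 * k.
  by rewrite /k; field; exact: lt0r_neq0.
rewrite -/k !kn in Phi Plo * => h1 h2.
have kP : k * (P / 2) <= k by rewrite ler_piMr ?ltW //; case/andP: P2; lra.
have k2 : k ^+ 2 <= k by rewrite expr2 ler_piMr // ltW.
move: h2; rewrite !ler_norml => /andP[h2 h3].
apply/andP; split; lra.
Qed.

End Search.

(** * Reduction of the graph walk to the five amplitudes *)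

Definition cls (V : zmodType) (N m : nat) (a b c x z : V) (u v : vtx N m) : V :=
  match u, v with
  | inl i, inl j => if i == j then 0 else if val i == 0%N then b
                    else if val j == 0%N then a else c
  | inl i, inr _ => if val i == 0%N then z else 0
  | inr _, inl j => if val j == 0%N then x else 0
  | inr _, inr _ => 0
  end.

Lemma sum_adj_hub (V : nmodType) (n m : nat) (F : vtx n.+1 m -> V) :
  \sum_(w | adj (inl ord0) w) F w
  = \sum_(j < n) F (inl (lift ord0 j)) + \sum_(k < m) F (inr k).
Proof.
rewrite big_sumType /=; congr (_ + _).
rewrite big_mkcond big_ord_recl /= add0r.
by apply: eq_bigr => j _.
Qed.

Lemma sum_adj_clique (V : nmodType) (n m : nat) (F : vtx n.+1 m -> V) (i : 'I_n) :
  \sum_(w | adj (inl (lift ord0 i)) w) F w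
  = F (inl ord0) + \sum_(j < n | j != i) F (inl (lift ord0 j)).
Proof.
rewrite big_sumType /= [X in _ + X]big_pred0 // addr0.
rewrite big_mkcond big_ord_recl /=; congr (_ + _).
rewrite [RHS]big_mkcond; apply: eq_bigr => j _.
by rewrite (inj_eq lift_inj) eq_sym.
Qed.

Lemma deg_hub (n m : nat) : deg (inl ord0 : vtx n.+1 m) = (n + m)%N.
Proof.
rewrite /deg -sum1_card.
rewrite (eq_bigl (fun w => adj (inl ord0 : vtx n.+1 m) w)); last first.
  by case=> [i|k] //; rewrite inE /= eq_sym.
by rewrite (sum_adj_hub (fun=> 1%N)) !sum_nat_const !card_ord !muln1.
Qed.

Lemma deg_clique (n m : nat) (i : 'I_n) :
  deg (inl (lift ord0 i) : vtx n.+1 m) = n.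
Proof.
rewrite /deg -sum1_card.
rewrite (eq_bigl (fun w => adj (inl (lift ord0 i) : vtx n.+1 m) w)); last first.
  by case=> [j|k] //; rewrite inE /= eq_sym.
rewrite (sum_adj_clique (fun=> 1%N)) sum_nat_const cardC1 card_ord muln1.
by case: n i => [[]|] //= n _; rewrite add1n.
Qed.

Definition embed5 (R : realType) (n m : nat) (v : vec5 R) : state R n.+1 m :=
  let: (a, b, c, x, z) := v in
  fun s t => (@cls R n.+1 m a b c x z s t)%:C%C.

Arguments embed5 {R} n m v.

Lemma sum_neq_const (R : pzRingType) n (i : 'I_n) (c : R) :
  \sum_(j < n | j != i) c = (n%:R - 1) * c.
Proof.
rewrite (eq_bigl (predC1 i)) // sumr_const cardC1 card_ord -[c *+ _]mulr_natl.
by case: n i => [[]|n] // _; rewrite /= -[n.+1%:R]natr1 addrK.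
Qed.

(** The arcs leaving [v*] are n of class [b] and m of class [z]; those leaving another clique vertex
    are one of class [a] and n - 1 of class [c]. The coin sums therefore depend on the class only.
    As [cls] is 0 off arcs, like [Uop], equality holds on all pairs. *)
Lemma Uop_embed5 (R : realType) (n m : nat) (v : vec5 R) :
  Uop (embed5 n m v) = embed5 n m (step5 n%:R m%:R v).
Proof.
case: v => [[[[a b] c] x] z]; apply/funext => s; apply/funext => t; rewrite /Uop.
have cN (r : R) : - (r%:C)%C = ((- r)%:C)%C by rewrite rmorphN.
case: t => [j|k]; last first.
  by case: s => [[[|i] hi]|k'] //=; rewrite cN.
have [j' ->|->] := unliftP ord0 j.
- rewrite sum_adj_clique deg_clique /embed5 -!rmorph_sum -!rmorphD -rmorphM -rmorphN -rmorphD.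
  (* The index [j'] itself witnesses n > 0. *)
  have n0 : n%:R != 0 :> R by rewrite pnatr_eq0 -lt0n (leq_ltn_trans _ (ltn_ord j')).
  rewrite (eq_bigr (fun=> c)); last first.
    by move=> j0 jj /=; rewrite (inj_eq lift_inj) eq_sym (negbTE jj).
  rewrite sum_neq_const.
  case: s => [i|k] //=; have [i' ->|->] := unliftP ord0 i => /=.
    rewrite [lift _ j' == _]eq_sym; case: eqP => //= _.
    by congr (_%:C)%C; field.
  by congr (_%:C)%C; field.
- have -> : \sum_(w | adj (inl ord0) w) embed5 n m (a, b, c, x, z) (inl ord0) w
           = (n%:R * b + m%:R * z)%:C%C.
    rewrite sum_adj_hub /= !sumr_const !card_ord rmorphD !rmorphM !rmorph_nat.
    by rewrite !mulr_natl.
  rewrite deg_hub /embed5 -rmorphM -rmorphN -rmorphD natrD.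
  case: s => [i|k] /=.
    have [i' ->|->] //= := unliftP ord0 i.
    have n0 : (n%:R + m%:R) != 0 :> R.
      by rewrite -natrD pnatr_eq0 -lt0n addn_gt0 (leq_ltn_trans _ (ltn_ord i')).
    by congr (_%:C)%C; field.
  have n0 : (n%:R + m%:R) != 0 :> R.
    by rewrite -natrD pnatr_eq0 -lt0n addn_gt0 (leq_ltn_trans _ (ltn_ord k)) ?orbT.
  by congr (_%:C)%C; field.
Qed.

Lemma psi_t_embed5 (R : realType) (n m t : nat) :
  let s := (Num.sqrt (n.+1 * n)%:R)^-1 : R in
  @psi_t R n.+1 m t = embed5 n m (iter t (step5 n%:R m%:R) (s, s, s, 0, 0)).
Proof.
move=> s; elim: t => [|t]; last by rewrite /psi_t /= => ->; rewrite Uop_embed5.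
apply/funext => u; apply/funext => v.
rewrite /psi_t /= /psi0 /s.
case: u => [i|k]; case: v => [j|k'] //=; rewrite ?andbF ?if_same //=.
by case: eqP => //= _; rewrite ?if_same subn1 div1r.
Qed.


Lemma success_embed5 (R : realType) (n m t : nat) :
  let s := (Num.sqrt (n.+1 * n)%:R)^-1 : R in
  success R n.+1 m t = found5 n%:R m%:R (iter t (step5 n%:R m%:R) (s, s, s, 0, 0)).
Proof.
move=> s; rewrite /success (big_pred1 (inl ord0)); last first.
  by case=> [i|k].
rewrite /prob psi_t_embed5 -/s.
set v := iter _ _ _; move: v => [[[[a b] c] x] z].
rewrite (eq_bigl (fun w => adj (inl ord0) w)); last first.
  by case=> [i|k] //; rewrite /= eq_sym.
rewrite sum_adj_hub.
congr (_ + _).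
  transitivity (\sum_(j < n) a ^+ 2); last by rewrite sumr_const card_ord mulr_natl.
  by apply: eq_bigr => j _; rewrite /sqnorm /= expr0n addr0.
transitivity (\sum_(k < m) x ^+ 2); last by rewrite sumr_const card_ord mulr_natl.
by apply: eq_bigr => j _; rewrite /sqnorm /= expr0n addr0.
Qed.

(** * Error bound on the graph and the limit in N *)

Lemma success_near_half (R : realType) (n m : nat) : (4 <= n)%N -> (1 <= m)%N ->
  exists t : nat, `|success R n.+1 m t - 1 / 2| <= 74 / Num.sqrt n%:R.
Proof.
move=> n4 m1; have n0 : (0 < n)%N by apply: leq_trans n4.
have n_gt0 : 0 < n%:R :> R by rewrite ltr0n.
have [||| t ht] := @found5_near_half R n%:R m%:R (Num.sqrt (n.+1 * n)%:R)^-1.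
- by rewrite ler_nat.
- by rewrite ler1n.
- rewrite exprVn sqr_sqrtr // natrM -natr1 [X in _ * X]mulrC mulVf //.
  by rewrite mulf_neq0 ?lt0r_neq0 // natr1 ltr0n.
by exists t; rewrite success_embed5.
Qed.

Unset Implicit Arguments.

Theorem theorem1 (R : realType) (alpha : R) (halpha : 0 <= alpha) :
  exists topt : nat -> nat,
    (fun N : nat => success R N (mstar alpha N) (topt N)) @ \oo --> (1 / 2 : R).
Proof.
(* Guarding the bound by 4 < N makes the existence total in N, as [choice] requires; for smaller N
   the time 0 is a dummy. *)
have key N : exists t : nat, (4 < N)%N ->
    `|success R N (mstar alpha N) t - 1 / 2| <= 74 / Num.sqrt N.-1%:R.
  case: (ltnP 4 N) => [|_]; last by exists 0%N.
  case: N => // n n4.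
  (* Here alpha >= 0 enters: N^alpha >= 1, so the star has a leaf. *)
  have m1 : (1 <= mstar alpha n.+1)%N.
    rewrite /mstar truncn_gt0.
    have n1 : 1 <= n.+1%:R :> R by rewrite ler1n.
    by have := ler_powR n1 halpha; rewrite powRr0.
  by have [t ht] := success_near_half R n4 m1; exists t.
have [topt Htopt] := choice key; exists topt.
apply/cvgrPdist_lt => e e0.
near=> N.
have N4 : (4 < N)%N by near: N; exact: nbhs_infty_gt.
rewrite distrC; apply: le_lt_trans (Htopt N N4) _.
have N1 : 0 < N.-1%:R :> R by rewrite ltr0n -subn1 subn_gt0 (leq_trans _ N4).
rewrite ltr_pdivrMr ?sqrtr_gt0 // mulrC -ltr_pdivrMr //.
rewrite -[ltLHS]ger0_norm ?divr_ge0 ?ltW // -sqrtr_sqr ltr_sqrt //.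
(* The goal 74/sqrt(N - 1) < e has become (74/e)^2 < N - 1. *)
have : (Num.truncn ((74 / e) ^+ 2)).+1%:R <= N.-1%:R :> R.
  rewrite ler_nat -ltnS prednK; last exact: leq_trans N4.
  by near: N; exact: nbhs_infty_gt.
by apply: lt_le_trans; exact: truncnS_gt.
Unshelve. all: by end_near. Qed.
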